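(* Let $n\ge2$, $T>0$, and let $v_0\equiv0$ in $\mathbb{R}^n$. Suppose that the pair $(v,p)$ is a generalized suitable weak solution on $\mathbb{R}^n\times(0,T)$ of the Navier-Stokes equations with initial velocity $v_0$. Assume that, for almost every $t\in(0,T)$, \[ \frac{1}{|B_{|x|/2}(x)|}\int_{B_{|x|/2}(x)}p(y,t)\,dy=o(|x|)\quad\text{as }|x|\to\infty , \] and that $v\in L^3(0,T;L^{q_1,r_1}(\mathbb{R}^n))\cap L^2(0,T;L^{q_2,r_2}(\mathbb{R}^n))$ for some $q_1,q_2,r_1,r_2$ with \[ 3\le q_1\le\frac{3n}{n-1},\quad 2\le q_2\le\frac{2n}{n-2},\quad 3\le r_1\le\infty,\quad 2\le r_2\le\infty \] satisfying one of the following: (Case 1) $(q_1,r_1)=\left(\frac{3n}{n-1},\infty\right)$, and $(q_2,r_2)\neq\left(\frac{2n}{n-2},\infty\right)$ if $n\ge3$, $q_2\neq\infty$ if $n=2$; (Case 2) $(q_1,r_1)\neq\left(\frac{3n}{n-1},\infty\right)$, and $(q_2,r_2)=\left(\frac{2n}{n-2},\infty\right)$ if $n\ge3$, $q_2=\infty$ if $n=2$; (Case 3) $(q_1,r_1)=\left(\frac{3n}{n-1},\infty\right)$, and $(q_2,r_2)=\left(\frac{2n}{n-2},\infty\right)$ if $n\ge3$, $q_2=\infty$ if $n=2$. Put \[ V_v(t)=\begin{cases}\|v\|_{L^3(0,t;L^{q_1,r_1})}^3 & (\text{Case 1}),\\ \|v\|_{L^2(0,t;L^{q_2,r_2})}^2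 & (\text{Case 2}),\\ \|v\|_{L^3(0,t;L^{q_1,r_1})}^3+\|v\|_{L^2(0,t;L^{q_2,r_2})}^2 & (\text{Case 3}),\end{cases} \] and let $C_0$ be the absolute constant described in the context. If there exists $\delta\in(0,1/C_0)$ such that \[ V_v(t_0)\le\delta\left(\|v(t_0)\|_{L^2}^2+2\int_0^{t_0}\|\nabla v(\tau)\|_{L^2}^2\,d\tau\right) \] for some $t_0\in(0,T)$, then $v(x,t)\equiv0$ on $\mathbb{R}^n\times[0,t_0]$.
   Context: Notation. $B_R(x)$ is the ball in $\mathbb{R}^n$ centered at $x$ with radius $R>0$, and $|B_R(x)|$ is its volume. For $n=2$, $\frac{2n}{n-2}$ is read as $\infty$. $L^2_\sigma(\mathbb{R}^n)$ is the closure in $L^2$ of the compactly supported $C^\infty$ solenoidal (divergence-free) vector fields on $\mathbb{R}^n$. $\dot H^1(\mathbb{R}^n)=\{f\in\mathcal D'(\mathbb{R}^n):\nabla f\in L^2(\mathbb{R}^n)\}$ with seminorm $\|\nabla f\|_{L^2}$, and $\dot H^1_\sigma(\mathbb{R}^n)$ is its solenoidal counterpart. The constant $C_0$. $C_0>0$ denotes the absolute constant in the following energy inequality (a theorem of the paper): for every $v_0\in L^2_\sigma(\mathbb{R}^n)$ and every generalized suitable weak solution $(v,p)$ with initial velocity $v_0$ such that, for almost every $t\in(0,T)$, \[ \frac{1}{|B_{|x|/2}(x)|}\int_{B_{|x|/2}(x)}p(y,t)\,dy=o(|x|)\quad\text{as }|x|\to\infty , \] and such that $v\in L^3(0,T;L^{q_1,r_1}(\mathbb{R}^n))\cap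 L^2(0,T;L^{q_2,r_2}(\mathbb{R}^n))$ for some $q_1,q_2,r_1,r_2$ with $3\le q_1\le\frac{3n}{n-1}$, $2\le q_2\le\frac{2n}{n-2}$, $3\le r_1\le\infty$, $2\le r_2\le\infty$ satisfying one of (Case 1) $(q_1,r_1)=\left(\frac{3n}{n-1},\infty\right)$, and $(q_2,r_2)\neq\left(\frac{2n}{n-2},\infty\right)$ if $n\ge3$, $q_2\neq\infty$ if $n=2$; (Case 2) $(q_1,r_1)\neq\left(\frac{3n}{n-1},\infty\right)$, and $(q_2,r_2)=\left(\frac{2n}{n-2},\infty\right)$ if $n\ge3$, $q_2=\infty$ if $n=2$; (Case 3) $(q_1,r_1)=\left(\frac{3n}{n-1},\infty\right)$, and $(q_2,r_2)=\left(\frac{2n}{n-2},\infty\right)$ if $n\ge3$, $q_2=\infty$ if $n=2$, one has $v\in L^\infty(0,T;L^2_\sigma(\mathbb{R}^n))\cap L^2(0,T;\dot H^1_\sigma(\mathbb{R}^n))$ and \[ \|v(t)\|_{L^2}^2+2\int_0^t\|\nabla v(\tau)\|_{L^2}^2\,d\tau\le\|v_0\|_{L^2}^2+C_0V_v(t)\quad\text{for all }t\in(0,T), \] where $V_v(t)=\|v\|_{L^3(0,t;L^{q_1,r_1})}^3$ in Case 1, $V_v(t)=\|v\|_{L^2(0,t;L^{q_2,r_2})}^2$ in Case 2, and $V_v(t)=\|v\|_{L^3(0,t;L^{q_1,r_1})}^3+\|v\|_{L^2(0,t;L^{q_2,r_2})}^2$ in Case 3. Lorentz spaces. For measurable $f$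 on $\mathbb{R}^n$ let $f^*(t)=\sup\{s\in(0,\infty):\mu(\{x:|f(x)|>s\})>t\}$, $\mu$ being Lebesgue measure. For $1\le q<\infty$, $L^{q,r}(\mathbb{R}^n)$ is the set of measurable $f$ with $\|f\|_{L^{q,r}}<\infty$, where $\|f\|_{L^{q,r}}=\left(\frac rq\int_0^\infty t^{r/q}f^*(t)^r\frac{dt}{t}\right)^{1/r}$ if $1\le r<\infty$, and $\|f\|_{L^{q,\infty}}=\sup_{t>0}t^{1/q}f^*(t)$. For $q=\infty$ and $1\le r\le\infty$, $L^{\infty,r}(\mathbb{R}^n):=L^\infty(\mathbb{R}^n)$. Navier-Stokes equations. $v_t-\Delta v+(v\cdot\nabla)v+\nabla p=0$, $\operatorname{div}v=0$ in $\mathbb{R}^n\times(0,T)$, $v(x,0)=v_0(x)$, where $v=(v^1,\dots,v^n)$ is the velocity and $p$ the pressure (a scalar function). Generalized suitable weak solution. Let $v_0\in L^2_\sigma(\mathbb{R}^n)$. A pair $(v,p)$ of measurable functions on $\mathbb{R}^n\times(0,T)$ is a generalized suitable weak solution of the Navier-Stokes equations if: (i) $v\in L^3_{loc}(\mathbb{R}^n\times[0,T))$, $\nabla v\in L^2_{loc}(\mathbb{R}^n\times[0,T))$, $p\in L^{3/2}_{loc}(\mathbb{R}^n\times[0,T))$; (ii) for every compact $K\subset\mathbb{R}^n$, $v(\cdot,t)$ is continuous for $t\in[0,T)$ in the weak topology of $L^2(K)$ and strongly continuous in $L^2(K)$ at $t=0$, i.e. $\int_K v(x,\cdot)\cdot\varphi(x)\,dx\in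 C([0,T))$ for all $\varphi\in L^2(K)$, and $\lim_{t\to0+}\int_K|v(x,t)-v_0(x)|^2dx=0$; (iii) $(v,p)$ satisfies the Navier-Stokes equations in the sense of distributions in $\mathbb{R}^n\times(0,T)$; (iv) for any nonnegative $\Phi\in C_0^\infty(\mathbb{R}^n\times(0,T))$, \[ 2\int_0^T\!\!\int_{\mathbb{R}^n}|\nabla v|^2\Phi\,dxdt\le\int_0^T\!\!\int_{\mathbb{R}^n}\left[|v|^2(\Phi_t+\Delta\Phi)+(|v|^2+2p)\,v\cdot\nabla\Phi\right]dxdt . \] *)

(* Defs.v *)
From HB Require Import structures.
From mathcomp Require Import all_boot all_order all_algebra.
From mathcomp Require Import all_classical all_reals all_analysis.

Set Implicit Arguments.
Unset Strict Implicit.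
Unset Printing Implicit Defensive.

Import Order.TTheory GRing.Theory Num.Theory.
Import numFieldNormedType.Exports.

Local Open Scope classical_set_scope.
Local Open Scope ring_scope.

(** * Lebesgue measure on R^n

    The library has no n-dimensional Lebesgue measure.  We take the Lebesgue
    outer measure and restrict it to its Caratheodory sets, so that
    "measurable" means Lebesgue measurable and the measure is complete. *)

Section lebesgue_measure_Rn.
Context (R : realType) (n : nat).

Definition box (ab : 'rV[R]_n * 'rV[R]_n) : set 'rV[R]_n :=
  [set x | forall i, ab.1 0 i <= x 0 i <= ab.2 0 i].

Definition box_volume (ab : 'rV[R]_n * 'rV[R]_n) : \bar R :=
  (\prod_i Num.max 0 (ab.2 0 i - ab.1 0 i))%:E.

Definition lebesgue_outer (A : set 'rV[R]_n) : \bar R :=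
  ereal_inf [set (\esum_(ab in S) box_volume ab)%E
            | S in [set S | countable S /\ A `<=` \bigcup_(ab in S) box ab]].

Lemma box_volume_ge0 ab : (0 <= box_volume ab)%E.
Proof. by rewrite lee_fin prodr_ge0// => i _; rewrite le_max lexx. Qed.

Lemma lebesgue_outer_ge0 A : (0 <= lebesgue_outer A)%E.
Proof.
apply: le_ereal_inf_tmp => _ [S _ <-].
by apply: esum_ge0 => *; exact: box_volume_ge0.
Qed.

Lemma lebesgue_outer0 : lebesgue_outer set0 = 0%E.
Proof.
apply/eqP; rewrite eq_le lebesgue_outer_ge0 andbT.
apply: ereal_inf_lbound; exists set0; last exact: esum_set0.
by split; [exact: countable0 | exact: sub0set].
Qed.

Lemma le_lebesgue_outer :
  {homo lebesgue_outer : A B / A `<=` B >-> (A <= B)%E}.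
Proof.
move=> A B AB; apply: ereal_inf_le_tmp => _ [S [cS BS] <-].
by exists S => //; split => //; exact: subset_trans BS.
Qed.

Lemma esum_bigcup_le (T : choiceType) (S : (set T)^nat) (a : T -> \bar R) :
  (forall x, 0 <= a x)%E ->
  (\esum_(x in \bigcup_k S k) a x <= \sum_(k <oo) \esum_(x in S k) a x)%E.
Proof.
move=> a0; rewrite seqDU_bigcup_eq.
rewrite (@esum_bigcupT _ _ _ (seqDU S) a (@trivIset_seqDU _ S) a0).
rewrite -nneseries_esumT; last by move=> k; exact: esum_ge0.
apply: lee_nneseries => [k _ _|k _]; first exact: esum_ge0.
rewrite esum_mkcond [leRHS]esum_mkcond; apply: le_esum => x _.
case: ifPn => [|_]; last by case: ifPn.
by rewrite inE => -[Sx _]; rewrite mem_set.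
Qed.

Lemma lebesgue_outer_sigma_subadditive : sigma_subadditive lebesgue_outer.
Proof.
move=> A; have [[i ioo]|] := pselect (exists i, lebesgue_outer (A i) = +oo%E).
  rewrite (eseries_pinfty _ _ ioo) ?leey// => k _.
  by rewrite -ltNye (lt_le_trans _ (lebesgue_outer_ge0 _)).
rewrite -forallNE => Aoo.
apply/lee_addgt0Pr => e e0.
apply: le_trans (epsilon_trick _ (fun k => lebesgue_outer_ge0 (A k)) (ltW e0)).
pose P k (S : set ('rV[R]_n * 'rV[R]_n)) :=
  (countable S /\ A k `<=` \bigcup_(ab in S) box ab) /\
  (\esum_(ab in S) box_volume ab
     <= lebesgue_outer (A k) + (e / (2 ^ k.+1)%:R)%:E)%E.
have [S PS] : {S & forall k, P k (S k)}.
  apply: (@choice _ _ P) => k.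
  have fin : lebesgue_outer (A k) \is a fin_num.
    by rewrite ge0_fin_numE ?lebesgue_outer_ge0// ltey; apply/eqP/Aoo.
  have ek : 0 < e / (2 ^ k.+1)%:R by rewrite divr_gt0// ltr0n expn_gt0.
  have [_ [S SA <-] lt] := lb_ereal_inf_adherent ek fin.
  by exists S; split => //; exact: ltW.
apply: (@le_trans _ _ (\esum_(ab in \bigcup_k S k) box_volume ab)%E).
  apply: ereal_inf_lbound; exists (\bigcup_k S k) => //; split.
    by apply: bigcup_countable => // k _; exact: (PS k).1.1.
  move=> x [k _ /((PS k).1.2) [ab Sab abx]].
  by exists ab => //; exists k.
apply: le_trans (esum_bigcup_le _ _) _; first exact: box_volume_ge0.
apply: lee_nneseries => [k _ _|k _]; last exact: (PS k).2.
by apply: esum_ge0 => *; exact: box_volume_ge0.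
Qed.

HB.instance Definition _ := isOuterMeasure.Build R 'rV[R]_n lebesgue_outer
  lebesgue_outer0 lebesgue_outer_ge0 le_lebesgue_outer
  lebesgue_outer_sigma_subadditive.

(** ['rV[R]_n] equipped with the Lebesgue sigma-algebra. *)
Definition Rn := caratheodory_type lebesgue_outer.
HB.instance Definition _ := Measurable.on Rn.

Definition leb : set Rn -> \bar R := lebesgue_outer.
HB.instance Definition _ := isMeasure.Build _ Rn R leb
  (caratheodory_measure0 lebesgue_outer)
  (@caratheodory_measure_ge0 _ _ lebesgue_outer)
  (@caratheodory_measure_sigma_additive _ _ lebesgue_outer).

End lebesgue_measure_Rn.
Arguments leb {R n}.


(** Time integrals also use the complete measure: [t |-> ||v t||] is in general
    only Lebesgue measurable. *)
Notation leb1 := completed_lebesgue_measure.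

Section analysis_Rn.
Context (R : realType).

(** Euclidean norm of a row vector, Frobenius norm of a matrix; the library
    norm of ['M[R]_(m, k)] is the maximum norm. *)
Definition enorm m k (A : 'M[R]_(m, k)) : R :=
  Num.sqrt (\sum_i \sum_j (A i j) ^+ 2).

Definition dot n (x y : 'rV[R]_n) : R := \sum_i x 0 i * y 0 i.

Definition eball n (x : 'rV[R]_n) (r : R) : set 'rV[R]_n :=
  [set y | enorm (y - x) < r].

Definition mx_measurable n m k (D : set 'rV[R]_n) (f : 'rV[R]_n -> 'M[R]_(m, k)) :=
  forall i j, measurable_fun (D : set (Rn R n)) (fun x => f x i j).

Definition sqnormL2 n m k (D : set 'rV[R]_n) (f : 'rV[R]_n -> 'M[R]_(m, k)) : \bar R :=
  (\int[leb]_(x in D) (enorm (f x) ^+ 2)%:E)%E.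

Definition L2 n m k (D : set 'rV[R]_n) (f : 'rV[R]_n -> 'M[R]_(m, k)) : Prop :=
  mx_measurable D f /\ (sqnormL2 D f < +oo)%E.

Definition partial m (i : 'I_m) (f : 'rV[R]_m -> R) : 'rV[R]_m -> R :=
  fun x => 'D_(delta_mx 0 i) f x.

Fixpoint Ck m (k : nat) (f : 'rV[R]_m -> R) : Prop :=
  match k with
  | 0 => continuous f
  | k'.+1 => continuous f /\
      forall i : 'I_m, (forall x, derivable f x (delta_mx 0 i)) /\
                       Ck k' (partial i f)
  end.

Definition test_fun m (U : set 'rV[R]_m) (f : 'rV[R]_m -> R) : Prop :=
  (forall k, Ck k f) /\
  exists K, [/\ compact K, K `<=` U & forall x, ~ K x -> f x = 0].

Definition solenoidal_test n (phi : 'rV[R]_n -> 'rV[R]_n) : Prop :=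
  (forall i, test_fun setT (fun x => phi x 0 i)) /\
  forall x, \sum_i partial i (fun y => phi y 0 i) x = 0.

Definition L2sigma n (f : 'rV[R]_n -> 'rV[R]_n) : Prop :=
  L2 setT f /\
  forall e : R, 0 < e -> exists phi,
    solenoidal_test phi /\ (sqnormL2 setT (fun x => f x - phi x)%R < e%:E)%E.

(** [f] is a solenoidal field with weak gradient [G x i j = d_j f^i (x)] in L^2.
    A distribution with gradient in L^2 is a function in L^2_loc. *)
Definition H1dot_sigma n (f : 'rV[R]_n -> 'rV[R]_n) (G : 'rV[R]_n -> 'M[R]_n) : Prop :=
  [/\ (forall K, compact K -> L2 K f),
      L2 setT G,
      (forall phi i j, test_fun setT phi ->
        (\int[leb]_(x in [set: Rn R n]) (f x 0 i * partial j phi x) =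
         - \int[leb]_(x in [set: Rn R n]) (G x i j * phi x))%R) &
      {ae leb, forall x : Rn R n, \tr (G x) = 0}].

End analysis_Rn.

Section lorentz.
Context (R : realType) (n : nat).
Implicit Types (f : 'rV[R]_n -> R) (q r : \bar R).

Definition rearrangement f (t : R) : \bar R :=
  ereal_sup (0%E |` [set s%:E | s in
    [set s : R | 0 < s /\ (t%:E < leb [set x : Rn R n | (s < `|f x|)%R])%E]]).

Definition lorentz_norm q r f : \bar R :=
  match q, r with
  | +oo%E, _ => 'N[@leb R n]_+oo [EFin \o f]
  | q%:E, r%:E =>
      (((r / q)%:E * \int[leb1]_(t in `]0%R, +oo[%classic)
          ((t `^ (r / q))%:E * rearrangement f t `^ r * (t^-1)%:E)) `^ r^-1)%E
  | q%:E, +oo%E =>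
      ereal_sup [set ((t `^ q^-1)%:E * rearrangement f t)%E
                | t in `]0%R, +oo[%classic]
  | _, _ => +oo%E
  end.

(** Norm of [L^s(0, t; L^{q,r})]. *)
Definition mixed_norm (s : R) q r (v : R -> 'rV[R]_n -> 'rV[R]_n) (t : R) : \bar R :=
  ((\int[leb1]_(tau in `]0%R, t[%classic)
      lorentz_norm q r (fun x => enorm (v tau x)) `^ s) `^ s^-1)%E.

End lorentz.

Section navier_stokes.
Context (R : realType) (n : nat).

(** Space-time points are the vectors [row_mx x t] of [R^(n+1)]. *)
Definition space (z : 'rV[R]_(n + 1)) : 'rV[R]_n := lsubmx z.
Definition time (z : 'rV[R]_(n + 1)) : R := z 0 (rshift n ord0).
Definition on_st A (f : R -> 'rV[R]_n -> A) (z : 'rV[R]_(n + 1)) : A :=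
  f (time z) (space z).

Definition slab (T : R) : set 'rV[R]_(n + 1) := [set z | 0 < time z < T].

Definition dx (i : 'I_n) (Phi : 'rV[R]_(n + 1) -> R) := partial (lshift 1 i) Phi.
Definition dt (Phi : 'rV[R]_(n + 1) -> R) := partial (rshift n ord0) Phi.
Definition laplacian (Phi : 'rV[R]_(n + 1) -> R) z := \sum_i dx i (dx i Phi) z.
Definition grad (Phi : 'rV[R]_(n + 1) -> R) z : 'rV[R]_n := \row_i dx i Phi z.

Definition st_int (T : R) (f : 'rV[R]_(n + 1) -> R) : R :=
  (\int[leb]_(z in (slab T : set (Rn R (n + 1)))) f z)%R.

Definition Lloc (T a : R) m k (f : 'rV[R]_(n + 1) -> 'M[R]_(m, k)) : Prop :=
  mx_measurable (slab T) f /\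
  forall K : set 'rV[R]_(n + 1), compact K -> K `<=` [set z | 0 <= time z < T] ->
    (\int[leb]_(z in (K : set (Rn R (n + 1)))) (enorm (f z) `^ a)%:E < +oo)%E.

Definition scalar_field (p : R -> 'rV[R]_n -> R) (t : R) (x : 'rV[R]_n) : 'M[R]_1 :=
  (p t x)%:M.

(** [Dv] is the distributional spatial gradient of [v], with
    [Dv t x i j = d_j v^i (x, t)]. *)
Definition weak_gradient (T : R) (v : R -> 'rV[R]_n -> 'rV[R]_n)
    (Dv : R -> 'rV[R]_n -> 'M[R]_n) : Prop :=
  forall Phi i j, test_fun (slab T) Phi ->
    st_int T (fun z => on_st v z 0 i * dx j Phi z) =
    - st_int T (fun z => on_st Dv z i j * Phi z).

Definition momentum_eq (T : R) (v : R -> 'rV[R]_n -> 'rV[R]_n)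
    (Dv : R -> 'rV[R]_n -> 'M[R]_n) (p : R -> 'rV[R]_n -> R) : Prop :=
  forall Phi i, test_fun (slab T) Phi ->
    st_int T (fun z => - on_st v z 0 i * dt Phi z
                       - on_st v z 0 i * laplacian Phi z
                       + (\sum_j on_st v z 0 j * on_st Dv z i j) * Phi z
                       - on_st p z * dx i Phi z) = 0.

Definition divergence_free (T : R) (v : R -> 'rV[R]_n -> 'rV[R]_n) : Prop :=
  forall Phi, test_fun (slab T) Phi ->
    st_int T (fun z => dot (on_st v z) (grad Phi z)) = 0.

Definition local_energy_ineq (T : R) (v : R -> 'rV[R]_n -> 'rV[R]_n)
    (Dv : R -> 'rV[R]_n -> 'M[R]_n) (p : R -> 'rV[R]_n -> R) : Prop :=
  forall Phi, test_fun (slab T) Phi -> (forall z, 0 <= Phi z) ->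
    2 * st_int T (fun z => enorm (on_st Dv z) ^+ 2 * Phi z) <=
    st_int T (fun z =>
      enorm (on_st v z) ^+ 2 * (dt Phi z + laplacian Phi z)
      + (enorm (on_st v z) ^+ 2 + 2 * on_st p z) * dot (on_st v z) (grad Phi z)).

(** [v t] is meaningful for every [t] in [0, T[, as an element of L^2_loc. *)
Definition weakly_continuous (T : R) (v : R -> 'rV[R]_n -> 'rV[R]_n) : Prop :=
  forall K : set 'rV[R]_n, compact K ->
    (forall t, 0 <= t < T -> L2 K (v t)) /\
    forall phi : 'rV[R]_n -> 'rV[R]_n, L2 K phi ->
      {within `[0, T[%classic, continuous (fun t : R =>
         (\int[leb]_(x in (K : set (Rn R n))) dot (v t x) (phi x))%R)}.

Definition initial_data (v : R -> 'rV[R]_n -> 'rV[R]_n) (v0 : 'rV[R]_n -> 'rV[R]_n) : Prop :=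
  forall K : set 'rV[R]_n, compact K ->
    sqnormL2 K (fun x => v t x - v0 x) @[t --> 0^'+] --> 0%E.

Record gen_suitable_weak_solution (T : R) (v0 : 'rV[R]_n -> 'rV[R]_n)
    (v : R -> 'rV[R]_n -> 'rV[R]_n) (Dv : R -> 'rV[R]_n -> 'M[R]_n)
    (p : R -> 'rV[R]_n -> R) : Prop := {
  gsws_v_L3loc : Lloc T 3 (on_st v);
  gsws_Dv_gradient : weak_gradient T v Dv;
  gsws_Dv_L2loc : Lloc T 2 (on_st Dv);
  gsws_p_L32loc : Lloc T (3 / 2) (on_st (scalar_field p));
  gsws_weakly_continuous : weakly_continuous T v;
  gsws_initial : initial_data v v0;
  gsws_momentum : momentum_eq T v Dv p;
  gsws_divergence_free : divergence_free T v;
  gsws_local_energy : local_energy_ineq T v Dv p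
}.

Definition ball_average (f : 'rV[R]_n -> R) (x : 'rV[R]_n) (r : R) : R :=
  (fine (leb (eball x r : set (Rn R n))))^-1 *
  (\int[leb]_(y in (eball x r : set (Rn R n))) f y)%R.

Definition pressure_decay (T : R) (p : R -> 'rV[R]_n -> R) : Prop :=
  {ae leb1, forall t : R, 0 < t < T ->
    forall e : R, 0 < e -> exists M : R, forall x : 'rV[R]_n, M < enorm x ->
      `|ball_average (p t) x (enorm x / 2)| <= e * enorm x}.

Definition q1_max : \bar R := ((3 * n)%:R / (n%:R - 1))%:E.
Definition q2_max : \bar R :=
  if n == 2%N then +oo%E else ((2 * n)%:R / (n%:R - 2))%:E.

Definition exponents_ok (q1 q2 r1 r2 : \bar R) : Prop :=
  [/\ (3%:E <= q1 <= q1_max)%E, (2%:E <= q2 <= q2_max)%E,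
      (3%:E <= r1 <= +oo)%E & (2%:E <= r2 <= +oo)%E].

Definition endpoint1 (q1 r1 : \bar R) : Prop := (q1, r1) = (q1_max, +oo%E).
Definition endpoint2 (q2 r2 : \bar R) : Prop :=
  if n == 2%N then q2 = +oo%E else (q2, r2) = (q2_max, +oo%E).

Variant endpoint_case := Case1 | Case2 | Case3.

Definition case_cond (c : endpoint_case) (q1 q2 r1 r2 : \bar R) : Prop :=
  match c with
  | Case1 => endpoint1 q1 r1 /\ ~ endpoint2 q2 r2
  | Case2 => ~ endpoint1 q1 r1 /\ endpoint2 q2 r2
  | Case3 => endpoint1 q1 r1 /\ endpoint2 q2 r2
  end.

Definition Vnorm (c : endpoint_case) (q1 q2 r1 r2 : \bar R)
    (v : R -> 'rV[R]_n -> 'rV[R]_n) (t : R) : \bar R :=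
  match c with
  | Case1 => (mixed_norm 3 q1 r1 v t `^ 3)%E
  | Case2 => (mixed_norm 2 q2 r2 v t `^ 2)%E
  | Case3 => (mixed_norm 3 q1 r1 v t `^ 3 + mixed_norm 2 q2 r2 v t `^ 2)%E
  end.

Definition energy (v : R -> 'rV[R]_n -> 'rV[R]_n) (Dv : R -> 'rV[R]_n -> 'M[R]_n)
    (t : R) : \bar R :=
  (sqnormL2 setT (v t) +
   2%:E * \int[leb1]_(tau in `]0%R, t[%classic) sqnormL2 setT (Dv tau))%E.

(** [C0] is a constant for which the energy inequality holds in dimension [n]. *)
Definition energy_constant (C0 : R) : Prop :=
  0 < C0 /\
  forall (T : R) (v0 : 'rV[R]_n -> 'rV[R]_n) (v : R -> 'rV[R]_n -> 'rV[R]_n)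
    (Dv : R -> 'rV[R]_n -> 'M[R]_n) (p : R -> 'rV[R]_n -> R)
    (q1 q2 r1 r2 : \bar R) (c : endpoint_case),
  0 < T -> L2sigma v0 -> gen_suitable_weak_solution T v0 v Dv p ->
  pressure_decay T p -> exponents_ok q1 q2 r1 r2 ->
  (mixed_norm 3 q1 r1 v T < +oo)%E -> (mixed_norm 2 q2 r2 v T < +oo)%E ->
  case_cond c q1 q2 r1 r2 ->
  [/\ (exists M : R, {ae leb1, forall t : R, 0 < t < T ->
         L2sigma (v t) /\ (sqnormL2 setT (v t) <= M%:E)%E}),
      {ae leb1, forall t : R, 0 < t < T -> H1dot_sigma (v t) (Dv t)},
      (\int[leb1]_(tau in `]0%R, T[%classic) sqnormL2 setT (Dv tau) < +oo)%E &
      forall t, 0 < t < T ->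
        (energy v Dv t <= sqnormL2 setT v0 + C0%:E * Vnorm c q1 q2 r1 r2 v t)%E].

End navier_stokes.

(* Main.v *)
(** Since v0 = 0, the energy E(t) is at most C0 V(t); at t0 this gives
    V(t0) <= delta C0 V(t0), where delta C0 < 1 and V(t0) is finite, so
    V(t0) = 0.  As V is nondecreasing, V = 0 on ]0, t0], hence E = 0 there and
    v(t) = 0.  The energy inequality says nothing at t = 0, which is
    reached by weak continuity. *)
Require Import Defs.
From mathcomp Require Import all_boot all_order all_algebra.
From mathcomp Require Import all_classical all_reals all_analysis.
From mathcomp Require Import measurable_realfun lra.

Set Implicit Arguments.
Unset Strict Implicit.
Unset Printing Implicit Defensive.

Import Order.TTheory GRing.Theory Num.Theory.
Import numFieldNormedType.Exports.

Local Open Scope classical_set_scope.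
Local Open Scope ring_scope.

(** * Monotonicity of nonnegative sums and integrals in their domain *)

Lemma subset_ge0_esum (R : realType) (T : choiceType) (A B : set T)
    (a : T -> \bar R) :
  (forall x, 0 <= a x)%E -> A `<=` B ->
  (\esum_(x in A) a x <= \esum_(x in B) a x)%E.
Proof.
move=> a0 AB; rewrite esum_mkcond [leRHS]esum_mkcond; apply: le_esum => x _.
case: ifPn => [|_]; last by case: ifPn.
by rewrite inE => /AB Bx; rewrite mem_set.
Qed.

(** Keeping one preimage for each point of the image discards only nonnegative terms. The inequality
    may be strict: [e] need not be injective, and distinct boxes can leave the same piece when cut
    by a hyperplane. *)
Lemma esum_image_le (R : realType) (T T' : choiceType) (S : set T)
    (e : T -> T') (a : T' -> \bar R) :
  (forall y, 0 <= a y)%E ->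
  (\esum_(y in e @` S) a y <= \esum_(x in S) a (e x))%E.
Proof.
move=> a0; have [->|/set0P[x0 _]] := eqVneq S set0.
  by rewrite image_set0 !esum_set0.
(* [g] selects a preimage in [S]; [x0] is its default value off the image. *)
have /choice[g gP] y : exists x, (e @` S) y -> S x /\ e x = y.
  by have [[x Sx exy]|nSy] := pselect ((e @` S) y); [exists x|exists x0].
have ginj : set_inj (e @` S) g.
  move=> y z /set_mem /gP[_ ey] /set_mem /gP[_ ez] gyz.
  by rewrite -ey -ez gyz.
rewrite [leLHS](_ : _ = \esum_(x in g @` (e @` S)) a (e x))%E.
  by apply: subset_ge0_esum => // _ [y eSy <-]; exact: (gP _ eSy).1.
by rewrite (esum_image _ _ (fun x => a (e x)) ginj); apply: eq_esum => y /gP[_ ->].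
Qed.

(* Unlike [ge0_subset_integral], no measurability is assumed: that of the time
   integrands is not known. *)
Lemma le_integral_subset_domain d (T : measurableType d) (R : realType)
    (mu : {measure set T -> \bar R}) (A B : set T) (f : T -> \bar R) :
  (forall x, 0 <= f x)%E -> A `<=` B ->
  (\int[mu]_(x in A) f x <= \int[mu]_(x in B) f x)%E.
Proof.
move=> f0 AB; rewrite !ge0_integralE//.
apply: ge_ereal_sup => _ [h /= hf <-]; apply: ereal_sup_ubound.
exists h => //= x; apply: le_trans (hf x) _; rewrite /patch.
case: ifPn => [|_]; last by case: ifPn.
by rewrite inE => /AB Bx; rewrite mem_set.
Qed.

(** * Measurability and compactness of boxes, and exhaustion of the space by cubes *)

Section boxes.
Context (R : realType) (n : nat).

(** If the box lies strictly above the hyperplane, the upper corner drops below the lower one: the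
    piece is empty, and the truncation at 0 in [box_volume] gives it volume 0. The same holds for
    [box_above] with the sides exchanged. *)
Definition box_below (i : 'I_n) (a : R) (ab : 'rV[R]_n * 'rV[R]_n) :=
  (ab.1, \row_j if j == i then Num.min (ab.2 0 j) a else ab.2 0 j).

Definition box_above (i : 'I_n) (a : R) (ab : 'rV[R]_n * 'rV[R]_n) :=
  (\row_j if j == i then Num.max (ab.1 0 j) a else ab.1 0 j, ab.2).

(** Only the [i]-th side is cut, so the other factors form a common product, and what remains is
    additivity of length for an interval cut at [a]. *)
Lemma box_volume_split (i : 'I_n) (a : R) (ab : 'rV[R]_n * 'rV[R]_n) :
  (box_volume (box_below i a ab) + box_volume (box_above i a ab) =
   box_volume ab)%E.
Proof.
rewrite /box_volume -EFinD; congr EFin => /=.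
rewrite (bigD1 i)//= [X in _ + X](bigD1 i)//= [RHS](bigD1 i)//=.
under eq_bigr => j ji do rewrite mxE (negbTE ji).
under [X in _ + _ * X]eq_bigr => j ji do rewrite mxE (negbTE ji).
rewrite -mulrDl !mxE eqxx; congr (_ * _).
rewrite /Num.max /Num.min; case: (ltP (ab.2 0 i)) => ?; case: (ltP (ab.1 0 i)) => ?.
all: by repeat (case: ltP => ?); lra.
Qed.

(* Cutting every box of a cover along the hyperplane [x 0 i = a] preserves the
   total volume. *)
Lemma measurable_halfspace (i : 'I_n) (a : R) (H : set 'rV[R]_n) :
  (forall x, H x -> x 0 i <= a) -> (forall x, ~ H x -> a <= x 0 i) ->
  measurable (H : set (Rn R n)).
Proof.
move=> Ha HCa; apply: le_caratheodory_measurable => X.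
apply: le_ereal_inf_tmp => _ [S [cS XS] <-].
rewrite -(eq_esum (fun ab _ => box_volume_split i a ab)) esumD; first last.
- by move=> *; exact: box_volume_ge0.
- by move=> *; exact: box_volume_ge0.
apply: leeD.
  apply: le_trans (esum_image_le _ _ _); last exact: box_volume_ge0.
  apply: ereal_inf_lbound; eexists; last reflexivity; split.
    exact: (sub_countable (card_image_le _ _)).
  move=> x [/XS[ab Sab abx] /Ha xa]; exists (box_below i a ab); first by exists ab.
  move=> j /=; rewrite mxE; have /andP[l u] := abx j.
  by rewrite l /=; case: eqP => [ji|//]; rewrite le_min u ji.
apply: le_trans (esum_image_le _ _ _); last exact: box_volume_ge0.
apply: ereal_inf_lbound; eexists; last reflexivity; split.
  exact: (sub_countable (card_image_le _ _)).
move=> x [/XS[ab Sab abx] /HCa xa]; exists (box_above i a ab); first by exists ab.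
move=> j /=; rewrite mxE; have /andP[l u] := abx j.
by rewrite u andbT; case: eqP => [ji|//]; rewrite ge_max l ji.
Qed.

Lemma measurable_box (ab : 'rV[R]_n * 'rV[R]_n) :
  measurable (box ab : set (Rn R n)).
Proof.
rewrite (_ : box ab = \bigcap_(i in [set: 'I_n])
    ((~` [set x : Rn R n | x 0 i < ab.1 0 i]) `&`
     [set x : Rn R n | x 0 i <= ab.2 0 i])); last first.
  apply/seteqP; split => x /= bx i.
    by move=> _; have /andP[l u] := bx i; split => //=; apply/negP; rewrite -leNgt.
  by have [/negP + ->] := bx i I; rewrite -leNgt => ->.
apply: fin_bigcap_measurable; first exact: finite_finset.
move=> i _; apply: measurableI.
  (* [measurable_halfspace] leaves open on which side the hyperplane itself falls, so it serves for
     the open half-space here and for the closed one next. *)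
  apply: measurableC; apply: (@measurable_halfspace i (ab.1 0 i)) => x /=.
    exact: ltW.
  by move/negP; rewrite -leNgt.
apply: (@measurable_halfspace i (ab.2 0 i)) => x //= /negP.
by rewrite -ltNge => /ltW.
Qed.

Lemma compact_box (ab : 'rV[R]_n * 'rV[R]_n) : compact (box ab).
Proof.
rewrite (_ : box ab = [set x | forall i, `[ab.1 0 i, ab.2 0 i]%classic (x ord0 i)]).
  apply: (@rV_compact R n (fun i => `[ab.1 0 i, ab.2 0 i]%classic)) => i.
  exact: segment_compact.
by apply/seteqP; split => x /= bx i; have := bx i; rewrite /= in_itv.
Qed.

(** The hypotheses on the solution are local, stated on compact sets; these cubes are a countable
    exhaustion by compact measurable sets. *)
Definition cube (k : nat) : set 'rV[R]_n :=
  box (const_mx (- k%:R), const_mx k%:R).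

Lemma measurable_cube k : measurable (cube k : set (Rn R n)).
Proof. exact: measurable_box. Qed.

Lemma compact_cube k : compact (cube k).
Proof. exact: compact_box. Qed.

Lemma bigcup_cube : \bigcup_k cube k = [set: 'rV[R]_n].
Proof.
apply/seteqP; split => // x _.
(* The sum of the absolute values bounds every coordinate, and the successor of its integer part
   exceeds it. *)
exists (Num.truncn (\sum_i `|x 0 i|)).+1 => // i; rewrite !mxE -ler_norml.
apply: le_trans (ltW (truncnS_gt _)); rewrite (bigD1 i)//= lerDl.
by apply: sumr_ge0.
Qed.

(** A countable union of null sets is null, so local statements pass to the whole space. *)
Lemma ae_cubes (P : 'rV[R]_n -> Prop) :
  (forall k, {ae leb, forall x : Rn R n, cube k x -> P x}) ->
  {ae leb, forall x : Rn R n, P x}.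
Proof.
move=> /ae_foralln; apply: filterS => x Px.
by have [k _ /Px] : (\bigcup_k cube k) x by rewrite bigcup_cube.
Qed.

End boxes.
Arguments cube {R n}.

(** * Fields with vanishing L^2 norm, and the zero field as initial velocity *)

Section square_norm.
Context (R : realType).

Lemma sqr_enorm m k (A : 'M[R]_(m, k)) :
  enorm A ^+ 2 = \sum_i \sum_j (A i j) ^+ 2.
Proof.
by rewrite sqr_sqrtr//; apply: sumr_ge0 => i _; apply: sumr_ge0 => j _; exact: sqr_ge0.
Qed.

Lemma sqr_enorm_eq0 m k (A : 'M[R]_(m, k)) : enorm A ^+ 2 = 0 -> A = 0.
Proof.
rewrite sqr_enorm => /eqP; rewrite psumr_eq0; last first.
  by move=> i _; apply: sumr_ge0 => j _; exact: sqr_ge0.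
move=> /allP A0; apply/matrixP => i j; rewrite mxE.
have := A0 i (mem_index_enum i); rewrite psumr_eq0; last first.
  by move=> *; exact: sqr_ge0.
by move=> /allP /(_ j (mem_index_enum j)); rewrite sqrf_eq0 => /eqP.
Qed.

Lemma enorm0 m k : enorm (0 : 'M[R]_(m, k)) = 0.
Proof.
rewrite /enorm big1 ?sqrtr0// => i _; rewrite big1// => j _.
by rewrite mxE expr0n.
Qed.

Lemma dotxx n (x : 'rV[R]_n) : dot x x = enorm x ^+ 2.
Proof. by rewrite sqr_enorm big_ord1. Qed.

Lemma sqnormL2_ge0 n m k (D : set 'rV[R]_n) (f : 'rV[R]_n -> 'M[R]_(m, k)) :
  (0 <= sqnormL2 D f)%E.
Proof. by apply: integral_ge0 => x _; rewrite lee_fin sqr_ge0. Qed.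

Lemma measurable_sqr_enorm n m k (D : set 'rV[R]_n) (f : 'rV[R]_n -> 'M[R]_(m, k)) :
  mx_measurable D f ->
  measurable_fun (D : set (Rn R n)) (fun x => enorm (f x) ^+ 2).
Proof.
move=> mf; under eq_fun do rewrite sqr_enorm.
apply: measurable_sum => i; apply: measurable_sum => j.
exact: (measurable_funX 2 (mf i j)).
Qed.

Lemma sqnormL2_eq0 n m k (D : set 'rV[R]_n) (f : 'rV[R]_n -> 'M[R]_(m, k)) :
  measurable (D : set (Rn R n)) -> mx_measurable D f -> sqnormL2 D f = 0%E ->
  {ae leb, forall x : Rn R n, D x -> f x = 0}.
Proof.
move=> mD mf f0.
have /(ae_eq_integral_abs (@leb R n) mD)[+ _] :
    measurable_fun (D : set (Rn R n)) (fun x => (enorm (f x) ^+ 2)%:E).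
  exact/measurable_EFinP/measurable_sqr_enorm.
have -> : (\int[leb]_(x in (D : set (Rn R n))) `|(enorm (f x) ^+ 2)%:E|)%E = 0%E.
  rewrite -f0; apply: eq_integral => x _.
  by rewrite gee0_abs// lee_fin sqr_ge0.
move=> /(_ erefl); apply: filterS => x + Dx => /(_ Dx) [].
exact: sqr_enorm_eq0.
Qed.

Lemma Rintegral_dot_ae0 n (D : set 'rV[R]_n) (f g : 'rV[R]_n -> 'rV[R]_n) :
  measurable (D : set (Rn R n)) -> mx_measurable D f -> mx_measurable D g ->
  {ae leb, forall x : Rn R n, f x = 0} ->
  (\int[leb]_(x in (D : set (Rn R n))) dot (f x) (g x))%R = 0.
Proof.
move=> mD mf mg f0; rewrite /Rintegral.
rewrite (@ae_eq_integral _ _ _ (@leb R n) D (cst 0%E))// ?integral0//.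
  apply/measurable_EFinP; apply: measurable_sum => i.
  by apply: measurable_funM; [exact: mf|exact: mg].
apply: filterS f0 => x fx0 _; rewrite /dot fx0 big1// => i _.
by rewrite mxE mul0r.
Qed.

Lemma sqnormL2_cst0 n m k (D : set 'rV[R]_n) (f : 'rV[R]_n -> 'M[R]_(m, k)) :
  (forall x, f x = 0) -> sqnormL2 D f = 0%E.
Proof. by move=> f0; apply: integral0_eq => x _; rewrite f0 enorm0 expr0n. Qed.

Lemma L2_cst0 n m k (D : set 'rV[R]_n) (f : 'rV[R]_n -> 'M[R]_(m, k)) :
  (forall x, f x = 0) -> L2 D f.
Proof.
move=> f0; split; last by rewrite sqnormL2_cst0.
by move=> i j; under eq_fun do rewrite f0 mxE; exact: measurable_cst.
Qed.

Lemma Ck_cst m k (c : R) : Ck k (fun _ : 'rV[R]_m => c).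
Proof.
(* The constant is generalized because the derivatives fall under the induction hypothesis with
   constant 0. *)
elim: k c => [|k IH] c /=; first exact: cst_continuous.
split=> [|i]; first exact: cst_continuous.
split=> [x|]; first exact: derivable_cst.
rewrite (_ : partial i _ = fun=> 0); first exact: IH.
by apply/funext => x; rewrite /partial derive_cst.
Qed.

Lemma solenoidal_test_cst0 n : solenoidal_test (fun _ : 'rV[R]_n => 0).
Proof.
split=> [i|x].
  split=> [k|]; first exact: Ck_cst.
  by exists set0; split => [|//|x _]; [exact: compact0|rewrite mxE].
by apply: big1 => i _; rewrite /partial derive_cst.
Qed.

(** Makes the energy inequality applicable to [v0]; the zero test field approximates it exactly. *)
Lemma L2sigma_cst0 n (f : 'rV[R]_n -> 'rV[R]_n) :
  (forall x, f x = 0) -> L2sigma f.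
Proof.
move=> f0; split=> [|e e0]; first exact: L2_cst0.
exists (fun=> 0); split; first exact: solenoidal_test_cst0.
by rewrite sqnormL2_cst0 ?lte_fin// => x; rewrite f0 subr0.
Qed.

End square_norm.

(** * Monotonicity and finiteness of the quantity V *)

Section mixed_norms.
Context (R : realType) (n : nat).
Implicit Types v : R -> 'rV[R]_n -> 'rV[R]_n.

Lemma le_mixed_norm (s : R) q r v (t u : R) : 0 <= s -> t <= u ->
  (mixed_norm s q r v t <= mixed_norm s q r v u)%E.
Proof.
move=> s0 tu; apply: gt0_ler_poweR; rewrite ?invr_ge0//.
- by rewrite in_itv/= leey andbT; apply: integral_ge0 => x _; exact: poweR_ge0.
- by rewrite in_itv/= leey andbT; apply: integral_ge0 => x _; exact: poweR_ge0.
apply: le_integral_subset_domain => [x|x /=]; first exact: poweR_ge0.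
by rewrite !in_itv/= => /andP[-> /lt_le_trans]; exact.
Qed.

Lemma Vnorm_ge0 c q1 q2 r1 r2 v t : (0 <= Vnorm c q1 q2 r1 r2 v t)%E.
Proof. by case: c; rewrite ?adde_ge0 ?poweR_ge0. Qed.

(** Time enters only through the integration interval ]0, t[, which grows with [t], and all the
    powers applied are nondecreasing. *)
Lemma le_Vnorm c q1 q2 r1 r2 v t u : t <= u ->
  (Vnorm c q1 q2 r1 r2 v t <= Vnorm c q1 q2 r1 r2 v u)%E.
Proof.
move=> tu.
have le_pow s q r : 0 <= s ->
    (mixed_norm s q r v t `^ s <= mixed_norm s q r v u `^ s)%E.
  move=> s0; apply: gt0_ler_poweR; rewrite ?in_itv/= ?leey ?poweR_ge0//.
  exact: le_mixed_norm.
by case: c => /=; [| |apply: leeD]; exact: le_pow.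
Qed.

Lemma Vnorm_lty c q1 q2 r1 r2 v t :
  (mixed_norm 3 q1 r1 v t < +oo)%E -> (mixed_norm 2 q2 r2 v t < +oo)%E ->
  (Vnorm c q1 q2 r1 r2 v t < +oo)%E.
Proof.
by move=> h1 h2; case: c => /=; [| |apply: lte_add_pinfty]; exact: poweR_lty.
Qed.

Lemma sqnormL2_le_energy v (Dv : R -> 'rV[R]_n -> 'M[R]_n) t :
  (sqnormL2 setT (v t) <= energy v Dv t)%E.
Proof.
rewrite leeDl// mule_ge0//; apply: integral_ge0 => x _; exact: sqnormL2_ge0.
Qed.

End mixed_norms.

(** * Passage to the initial time *)

(** On each cube the pairing of [v t] with a fixed L^2 field is continuous up to time 0 and vanishes
    at the positive times up to [t0], hence also at time 0. *)
Lemma weakly_continuous_ae0 (R : realType) (n : nat) (T t0 : R)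
    (v : R -> 'rV[R]_n -> 'rV[R]_n) :
  weakly_continuous T v -> 0 < t0 < T ->
  (forall t, 0 < t <= t0 -> {ae leb, forall x : Rn R n, v t x = 0}) ->
  {ae leb, forall x : Rn R n, v 0 x = 0}.
Proof.
move=> vwc /andP[t0_gt0 t0T] v0; apply: ae_cubes => k.
have mK := @measurable_cube R n k.
have [vL2 vcont] := vwc _ (@compact_cube R n k).
have v0L2 : L2 (cube k) (v 0) by apply: vL2; rewrite lexx (lt_trans t0_gt0).
(* Restriction to a closed interval turns continuity into a right limit at its left endpoint. *)
have : {within `[0, t0], continuous (fun t : R =>
    (\int[leb]_(x in (cube k : set (Rn R n))) dot (v t x) (v 0 x))%R)}.
  apply: continuous_subspaceW (vcont _ v0L2) => t /=; rewrite !in_itv/=.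
  by move=> /andP[-> /le_lt_trans]; exact.
move=> /(continuous_within_itvP _ t0_gt0)[_ cv0 _].
(* Weak continuity is tested against [v 0] itself. *)
have int0 : (\int[leb]_(x in (cube k : set (Rn R n))) dot (v 0 x) (v 0 x))%R = 0.
  apply: (norm_cvg_unique cv0) => /=.
  apply: cvg_near_cst; near=> t.
  have tt0 : 0 < t <= t0 by apply/andP; split; near: t;
    [exact: nbhs_right_gt|exact: nbhs_right_le].
  apply: Rintegral_dot_ae0 => //; [|exact: v0L2.1|exact: v0].
  by apply: (vL2 _ _).1; case/andP: tt0 => /ltW-> /= /le_lt_trans; exact.
apply: sqnormL2_eq0; [exact: mK|exact: v0L2.1|].
(* The real integral is the [fine] part of the extended one, so its vanishing yields that of
   [sqnormL2] only because the latter is finite. *)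
rewrite -[LHS]fineK.
  by congr EFin; rewrite -[RHS]int0; apply: eq_Rintegral => x _; rewrite dotxx.
by rewrite ge0_fin_numE ?sqnormL2_ge0//; exact: v0L2.2.
Unshelve. all: by end_near. Qed.

(** * Absorption of V into the energy, and vanishing of the solution *)

Unset Implicit Arguments.

Theorem corollary1p5 (R : realType) (n : nat) (hn : (2 <= n)%N)
  (C0 : R) (hC0 : energy_constant n C0)
  (T : R) (hT : 0 < T)
  (v0 : 'rV[R]_n -> 'rV[R]_n) (hv0 : forall x, v0 x = 0)
  (v : R -> 'rV[R]_n -> 'rV[R]_n) (Dv : R -> 'rV[R]_n -> 'M[R]_n)
  (p : R -> 'rV[R]_n -> R)
  (hsol : gen_suitable_weak_solution T v0 v Dv p)
  (hp : pressure_decay T p)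
  (q1 q2 r1 r2 : \bar R) (hq : exponents_ok n q1 q2 r1 r2)
  (hv1 : (mixed_norm 3 q1 r1 v T < +oo)%E)
  (hv2 : (mixed_norm 2 q2 r2 v T < +oo)%E)
  (c : endpoint_case) (hc : case_cond n c q1 q2 r1 r2)
  (delta : R) (hdelta : 0 < delta < 1 / C0)
  (t0 : R) (ht0 : 0 < t0 < T)
  (hsmall : (Vnorm c q1 q2 r1 r2 v t0 <= delta%:E * energy v Dv t0)%E) :
  forall t, 0 <= t <= t0 -> {ae leb, forall x : Rn R n, v t x = 0}.
Proof.
have [C0_gt0 /(_ T v0 v Dv p q1 q2 r1 r2 c hT (L2sigma_cst0 hv0) hsol hp
  hq hv1 hv2 hc)[_ _ _ energy_le]] := hC0.
have {}energy_le t : 0 < t < T ->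
    (energy v Dv t <= C0%:E * Vnorm c q1 q2 r1 r2 v t)%E.
  by move=> /energy_le; rewrite sqnormL2_cst0// add0e.
have /andP[t0_gt0 t0T] := ht0; have /andP[delta_gt0 deltaC0] := hdelta.
have V0 : Vnorm c q1 q2 r1 r2 v t0 = 0%E.
  (* Absorption needs a finite V(t0): an infinite value would satisfy the inequality too. Finiteness
     comes from the bound by V(T). *)
  have Vfin : Vnorm c q1 q2 r1 r2 v t0 \is a fin_num.
    rewrite ge0_fin_numE ?Vnorm_ge0//.
    exact: le_lt_trans (le_Vnorm _ _ _ _ _ _ (ltW t0T)) (Vnorm_lty c hv1 hv2).
  have /fineK Veq := Vfin; have := Vnorm_ge0 c q1 q2 r1 r2 v t0.
  have := le_trans hsmall (lee_wpmul2l _ (energy_le _ ht0)).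
  rewrite lee_fin -Veq -!EFinM !lee_fin => /(_ (ltW delta_gt0)).
  (* For a real V > 0, the bound V <= delta C0 V contradicts delta C0 < 1, which is [deltaC0]
     multiplied by [C0]. *)
  move: (fine _) => V Vle V_ge0; congr EFin; apply/eqP.
  rewrite eq_le V_ge0 andbT leNgt; apply/negP => V_gt0.
  move: Vle; rewrite mulrA leNgt gtr_pMl//.
  by rewrite -ltr_pdivlMr ?deltaC0.
have v_ae0 t : 0 < t <= t0 -> {ae leb, forall x : Rn R n, v t x = 0}.
  move=> /andP[t_gt0 tt0]; have tT := le_lt_trans tt0 t0T.
  have Vt0 : Vnorm c q1 q2 r1 r2 v t = 0%E.
    apply/eqP; rewrite eq_le Vnorm_ge0 andbT -V0; exact: le_Vnorm.
  have vt0 : (sqnormL2 setT (v t) <= 0)%E.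
    apply: le_trans (sqnormL2_le_energy _ Dv _) _.
    by have := energy_le t; rewrite Vt0 mule0 t_gt0 tT; exact.
  (* Measurability of [v t] is supplied on compact sets, so the vanishing of the norm is exploited
     cube by cube. *)
  apply: ae_cubes => k; apply: sqnormL2_eq0.
  - exact: measurable_cube.
  - have [+ _] := gsws_weakly_continuous hsol (@compact_cube R n k).
    by move=> /(_ t); rewrite (ltW t_gt0) tT => /(_ isT)[].
  - apply/eqP; rewrite eq_le sqnormL2_ge0 andbT; apply: le_trans vt0.
    by apply: le_integral_subset_domain => // x; rewrite lee_fin sqr_ge0.
move=> t /andP[]; rewrite le_eqVlt => /predU1P[<- _|t_gt0 tt0].
  exact: weakly_continuous_ae0 (gsws_weakly_continuous hsol) ht0 v_ae0.
by apply: v_ae0; rewrite t_gt0.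
Qed.
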